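(* If $\mathfrak{p}=\mathrm{cof}(\mathcal{M})$, then there is a locally compact, discretely generated Hausdorff space $X$ whose one-point compactification is not discretely generated. Moreover, every point of $X$ has character (in $X$) strictly less than $\mathfrak{p}$.
   Context: A topological space $X$ is discretely generated at a point $p\in X$ if for every $A\subset X$ with $p\in\mathrm{cl}_X(A)$ there is a subset $D\subset A$ that is discrete (in its subspace topology) with $p\in\mathrm{cl}_X(D)$. The space $X$ is discretely generated if it is discretely generated at each of its points. $\mathcal{M}$ is the family of all meager subsets of ${}^{\omega}\omega$ (product topology, $\omega$ discrete), and $\mathrm{cof}(\mathcal{M})$ is the least cardinality of a family $\mathcal{G}\subset\mathcal{M}$ that is cofinal in $\langle\mathcal{M},\subset\rangle$ (every meager set is contained in a member of $\mathcal{G}$). Let $[\omega]^\omega$ be the set of infinite subsets of $\omega$. A family $\mathcal{G}\subset[\omega]^\omega$ is centered if for all $G_0,\ldots,G_n\in\mathcal{G}$ there is $G\in\mathcal{G}$ with $G\subset G_0\cap\ldots\cap G_n$; a pseudointersection of $\mathcal{G}$ is a set $A\in[\omega]^\omega$ with $A\setminus G$ finite for all $G\in\mathcal{G}$. $\mathfrak{p}$ is the least cardinality of a centered family $\mathcal{G}\subset[\omega]^\omega$ with no pseudointersection. *)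

(* Defs.v *)
From mathcomp Require Import all_boot all_classical topology.

Set Implicit Arguments.
Unset Strict Implicit.
Unset Printing Implicit Defensive.

Local Open Scope classical_set_scope.
Local Open Scope card_scope.

Definition card_lt {T U : Type} (A : set T) (B : set U) : Prop :=
  A #<= B /\ ~ (B #<= A).

(* A cardinal is represented by a set having that cardinality: the least *)
(* cardinality of a member of P is given by a chosen member of P that    *)
(* injects into every member of P. Such a member exists as soon as P is  *)
(* nonempty, by least_cardP; the value set0 for empty P is never meant.  *)
Definition least_card {T : Type} (P : set (set T)) : set T :=
  xget set0 [set G | P G /\ forall H, P H -> G #<= H].

Lemma least_cardP {T : pointedType} (P : set (set T)) : P !=set0 ->
  P (least_card P) /\ forall H, P H -> least_card P #<= H.
Proof.
move=> [A0 PA0]; apply: (xgetPex set0 (P := [set G | P G /\ forall H, P H -> G #<= H])) => /=.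
pose ok (S : set (set T -> T)) := (forall f A, S f -> P A -> A (f A)) /\
  (forall f g A, S f -> S g -> P A -> f A = g A -> f = g).
have [|S [[S1 S2] Smax]] := @Zorn_bigcup _ ok.
  move=> F FS Ftot; split=> [f A [S FS' Sf] PA|f g A [S FS' Sf] [S' FS'' S'g] PA fg].
    by have [h _] := FS _ FS'; exact: h Sf PA.
  have [/(_ _ Sf) S'f|/(_ _ S'g) Sg] := Ftot _ _ FS' FS''.
    by have [_ h] := FS _ FS''; exact: h S'f S'g PA fg.
  by have [_ h] := FS _ FS'; exact: h Sf Sg PA fg.
have [[A PA Asurj]|nsurj] := pselect (exists2 A, P A &
    forall a, A a -> exists2 f, S f & f A = a); last first.
  have ext A : exists a, P A -> A a /\ forall f, S f -> f A <> a.
    have [PA|nPA] := pselect (P A); last by exists point.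
    apply: contrapT => /forallNP h; apply: nsurj; exists A => // a Aa.
    apply: contrapT => nf; apply: (h a) => _; split => // f Sf fA.
    by apply: nf; exists f.
  have [c cP] := choice ext.
  exfalso; apply: (Smax (S `|` [set c])).
    split; first by move=> ?; left.
    move=> h; have [_ /(_ c)] := cP _ PA0; apply=> //.
    by apply: h; right.
  split=> [f A [Sf|->] PA|f g A [Sf|->] [Sg|->] PA fg //].
  - by exact: S1 Sf PA.
  - by have [cA _] := cP A PA.
  - by exact: S2 Sf Sg PA fg.
  - by have [_ /(_ f Sf) /(_ fg)] := cP A PA.
  - by have [_ /(_ g Sg) /(_ (esym fg))] := cP A PA.
exists A; split => // H PH.
have Asurj' a : exists f, A a -> S f /\ f A = a.
  have [Aa|nAa] := pselect (A a); last by exists (fun=> point).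
  by have [f Sf fA] := Asurj _ Aa; exists f.
have [s sP] := choice Asurj'.
have Hs : set_fun A H (fun a => s a H).
  by move=> a Aa; have [Sa _] := sP _ Aa; exact: S1 Sa PH.
have inj : {in A &, injective (fun a => s a H)}.
  move=> a b /set_mem Aa /set_mem Ab /= sab.
  have [Sa <-] := sP _ Aa; have [Sb <-] := sP _ Ab.
  by rewrite (S2 _ _ _ Sa Sb PH sab).
have := inj_card_eq inj; rewrite card_eq_le => /andP[_] /card_le_trans; apply.
by apply: subset_card_le => _ [a Aa <-]; exact: Hs.
Qed.

Section topology.
Context {X : topologicalType}.

(* set_type D carries the subspace topology. *)
Definition discrete_subset (D : set X) : Prop :=
  forall U : set (set_type D), open U.

Definition discretely_generated_at (p : X) : Prop :=
  forall A : set X, closure A p ->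
    exists D, [/\ D `<=` A, discrete_subset D & closure D p].

Definition nowhere_dense (A : set X) : Prop := interior (closure A) = set0.

Definition meager (A : set X) : Prop :=
  exists2 F : nat -> set X,
    (forall n, nowhere_dense (F n)) & A = \bigcup_n F n.

Definition local_base (x : X) (B : set (set X)) : Prop :=
  B `<=` open_nbhs x /\
  forall U, open_nbhs x U -> exists2 V, B V & V `<=` U.

Definition character (x : X) : set (set X) := least_card (local_base x).

End topology.

Definition discretely_generated (X : topologicalType) : Prop :=
  forall p : X, discretely_generated_at p.

(* The topology that the library puts on nat is the discrete one. *)
Definition baire_space : topologicalType := {ptws nat -> nat}.

Definition cofinal_meager (G : set (set baire_space)) : Prop :=
  G `<=` meager /\ forall A, meager A -> exists2 B, G B & A `<=` B.

Definition cof_meager : set (set baire_space) := least_card cofinal_meager.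

Definition infinite_family (G : set (set nat)) : Prop :=
  forall A, G A -> infinite_set A.

Definition centered (G : set (set nat)) : Prop :=
  forall (n : nat) (A : nat -> set nat), (forall i, (i <= n)%N -> G (A i)) ->
    exists2 B, G B & forall i, (i <= n)%N -> B `<=` A i.

Definition pseudointersection (G : set (set nat)) (A : set nat) : Prop :=
  infinite_set A /\ forall B, G B -> finite_set (A `\` B).

Definition pseudointersection_number : set (set nat) :=
  least_card [set G | [/\ infinite_family G, centered G &
    ~ exists A, pseudointersection G A]].

(* Main.v *)
From HB Require Import structures.
Require Import Defs.
From mathcomp Require Import all_boot all_classical topology.
From mathcomp Require Import wochoice.
Local Open Scope classical_set_scope.
Local Open Scope card_scope.

Set Implicit Arguments.
Unset Strict Implicit.
Unset Printing Implicit Defensive.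

(** Let Y be the disjoint union of countably many Cantor sets ("slices") and let
    J be a well-ordered set of cardinality p all of whose proper initial
    segments have cardinality less than p. The space X is a variant of the
    Franklin-Rajagopalan space: Y is open in X, a copy of J is attached to it
    along a tower of clopen sets O a of Y (a in J), decreasing modulo finitely
    many slices, and the sets (Y \ O a) + {c | c <= a} are compact and open.

    The tower is built by recursion on a: fewer than p requirements are met at
    each step by a pseudointersection, so O a can be chosen to be nonempty on
    infinitely many slices and disjoint from a prescribed nowhere dense set N a.
    Since p = cof(M), the sets N a can be taken cofinal among the nowhere dense
    sets of Y modulo finitely many slices; the passage from meager subsets of
    Baire space to sequences of nowhere dense sets goes through the
    characterization of meager sets by interval partitions and matching reals.

    Every discrete subset of Y is nowhere dense, hence relatively compact in X,
    whereas Y is not: the one-point compactification is not discretely generated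
    at infinity. X itself is discretely generated: if x is in the closure of
    A <= Y, then a countable part of A suffices and a pseudointersection yields
    a sequence converging to x, because the character of x is less than p; and
    X \ Y is scattered. *)

(** * Cardinals *)

Lemma card_le_surj {T U : Type} (A : set T) (B : set U) (f : T -> U) :
  (forall y, B y -> exists2 x, A x & f x = y) -> B #<= A.
Proof.
move=> h; apply: card_le_trans (card_image_le f A).
by apply: subset_card_le => y /h[x Ax <-]; exists x.
Qed.

Lemma card_le_inj {T U : Type} (A : set T) (B : set U) (f : T -> U) :
  (forall x, A x -> B (f x)) ->
  (forall x y, A x -> A y -> f x = f y -> x = y) -> A #<= B.
Proof.
move=> fB finj.
have : {in A &, injective f} by move=> x y /set_mem Ax /set_mem Ay; exact: finj.
move=> /inj_card_eq; rewrite card_eq_le => /andP[_] /card_le_trans; apply.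
by apply: subset_card_le => _ [x /fB Bfx <-].
Qed.

Lemma card_le_exinj {T U : Type} (A : set T) (B : set U) : A #<= B ->
  exists f : set_type A -> U, (forall x, B (f x)) /\ injective f.
Proof.
move=> /card_leP[f]; exists (fun x => \val (f x)); split=> [x|x y /val_inj fxy].
  exact: set_valP.
by apply: (@inj _ _ _ f) => //; rewrite in_setT.
Qed.

Lemma card_le_exsurj {T U : Type} (A : set T) (B : set U) : A !=set0 ->
  A #<= B -> exists g : U -> T, forall x, A x -> exists2 y, B y & g y = x.
Proof.
move=> [a Aa] /card_le_exinj[f [fB finj]].
have gex y : exists x : T, forall x', f x' = y -> x = set_val x'.
  have [[x' fx']|nf] := pselect (exists x', f x' = y).
    exists (set_val x') => x'' fx''; congr set_val.
    by apply: finj; rewrite fx' fx''.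
  by exists a => x' fx'; exfalso; apply: nf; exists x'.
have [g gP] := choice gex; exists g => x Ax.
by exists (f (SigSub (mem_set Ax))) => //; rewrite (gP _ _ erefl).
Qed.

Lemma infinite_exinj {T : Type} (A : set T) : infinite_set A ->
  exists u : nat -> T, (forall i, A (u i)) /\ injective u.
Proof.
move=> /infiniteP/card_le_exinj[f [fA finj]].
exists (fun i => f (SigSub (mem_set (I : [set: nat] i)))); split=> // i j /finj.
by move=> /(congr1 set_val).
Qed.

(* A maximal disjoint family of injective sequences in Z covers Z up to a finite
   set. *)
Lemma card_leX_nat {T : Type} (Z : set T) :
  infinite_set Z -> Z `*` [set: nat] #<= Z.
Proof.
move=> Zinf.
pose ok (S : set (nat -> T)) :=
  (forall u, S u -> (forall i, Z (u i)) /\ injective u) /\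
  (forall u v i j, S u -> S v -> u i = v j -> u = v).
have [|S [[SZ Sdisj] Smax]] := @Zorn_bigcup _ ok.
  move=> F FS Ftot; split=> [u [S FS' Su]|u v i j [S FS1 Su] [S' FS2 Sv] uv].
    by have [h _] := FS _ FS'; exact: h.
  have [/(_ _ Su) S'u|/(_ _ Sv) S'v] := Ftot _ _ FS1 FS2.
    by have [_ h] := FS _ FS2; exact: h uv.
  by have [_ h] := FS _ FS1; exact: h uv.
pose R := Z `\` [set x | exists2 u, S u & exists i, u i = x].
have Rfin : finite_set R.
  apply: contrapT => /infinite_exinj[u [uR uinj]].
  have nSu v i j : S v -> v i <> u j.
    by move=> Sv vu; have [_] := uR j; apply; exists v => //; exists i.
  apply: (Smax (S `|` [set u])).
    split; first by move=> ?; left.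
    by move=> h; apply: (nSu u 0 0) => //; apply: h; right.
  split=> [v [/SZ//|->]|v w i j [Sv|->] [Sw|->] vw //].
  - by split=> // i; have [] := uR i.
  - exact: Sdisj vw.
  - by exfalso; exact: nSu vw.
  - by exfalso; exact: nSu (esym vw).
have [u0 Su0] : exists u, S u.
  apply: contrapT => nS; apply: Zinf; apply: sub_finite_set Rfin => x Zx.
  by split=> // -[u Su]; case: nS; exists u.
have [z Zz] := infinite_setN0 Zinf.
(* The finite leftover [R] is absorbed into the sequence [u0], which makes the pairs from [S] and
   [nat] cover [Z]. *)
pose R0 := R `|` range u0.
have R0c : R0 #<= [set: nat].
  have -> : R0 = \bigcup_(b in [set: bool]) (if b then R else range u0).
    apply/seteqP; split=> x; first by case=> ?; [exists true|exists false].
    by case=> -[] _ ?; [left|right].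
  apply: bigcup_countable => [|[] _]; first exact: countableP.
    exact: finite_set_countable.
  exact: card_image_le.
have R00 : R0 !=set0 by exists (u0 0); right; exists 0.
have [e eP] := card_le_exsurj R00 R0c.
pose g (p : (nat -> T) * nat) := if `[< p.1 = u0 >] then e p.2 else p.1 p.2.
have gP x : Z x -> exists2 p, (S `*` [set: nat]) p & g p = x.
  move=> Zx; have [R0x|nR0x] := pselect (R0 x).
    have [i _ ei] := eP _ R0x.
    by exists (u0, i) => //; rewrite /g /=; case: asboolP.
  have [[v Sv [i vi]]|nv] := pselect (exists2 v, S v & exists i, v i = x).
    exists (v, i) => //; rewrite /g /=; case: asboolP => // vu0.
    by exfalso; apply: nR0x; right; exists i => //; rewrite -vu0.
  by exfalso; apply: nR0x; left.
apply: (@card_le_trans _ _ _ ((S `*` [set: nat]) `*` [set: nat])).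
  apply: (@card_le_surj _ _ _ _ (fun q => (g q.1, q.2))).
  move=> [x n] [/gP[p Sp gp] _].
  by exists (p, n) => //=; rewrite gp.
(* Each sequence of [S] has room for countably many copies of [nat], coded by [pickle]. *)
apply: (@card_le_inj _ _ _ _ (fun q => q.1.1 (pickle (q.1.2, q.2)))).
  by move=> [[u i] j] [[Su _] _] /=; have [] := SZ _ Su.
move=> [[u i] j] [[v k] l] [[/= Su _] _] [[/= Sv _] _] uv.
have uv' := Sdisj _ _ _ _ Su Sv uv; rewrite -uv' in uv *.
by have [_ /(_ _ _ uv)/(pcan_inj pickleK)[-> ->]] := SZ _ Su.
Qed.

(** Stands in for the initial ordinal of the cardinality of [P]. Well-order [P]; if a proper initial
    segment is already as large as [P], cut at the least such segment. *)
Lemma ordinal_index {T : choiceType} (P : set T) :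
  exists (J : choiceType) (lt : J -> J -> Prop),
    [/\ well_founded lt,
        forall a b c, lt a b -> lt b c -> lt a c,
        forall a b, [\/ lt a b, a = b | lt b a],
        [set: J] #= P &
        forall a, ~ (P #<= [set b | lt b a])].
Proof.
have [R Rwo] := well_ordering_principle (set_type P : eqType).
have RwoT : wo_chain R predT by move=> A _; exact: Rwo.
have Rrefl x : R x x by exact: (wo_chain_reflexive RwoT).
have Rtot x y : R x y || R y x by exact: (wo_chainW RwoT).
have Ranti x y : R x y -> R y x -> x = y.
  by move=> xy yx; apply: (wo_chain_antisymmetric RwoT); rewrite ?xy.
have Rmin (A : set (set_type P)) : A !=set0 ->
    exists2 x, A x & forall y, A y -> R x y.
  move=> [x Ax]; have [|z [[zA zmin] _]] := Rwo (fun x => x \in A).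
    by exists x; exact: mem_set.
  by exists z; [exact: set_mem|move=> y Ay; apply: zmin; exact: mem_set].
have Rtr x y z : R x y -> R y z -> R x z.
  move=> xy yz; have [|w] := Rmin [set x; y; z]; first by exists x; left; left.
  move=> [[->|->]|->] h.
  - by apply: h; right.
  - by rewrite (Ranti x y xy) //; apply: h; left; left.
  - by rewrite -(Ranti y z yz) //; apply: h; left; right.
pose lt x y := R x y /\ x <> y.
have lt_tr x y z : lt x y -> lt y z -> lt x z.
  move=> [xy nxy] [yz nyz]; split; first exact: Rtr yz.
  by move=> xz; apply: nyz; apply: Ranti => //; rewrite -xz.
have lt_tot x y : [\/ lt x y, x = y | lt y x].
  have [->|nxy] := pselect (x = y); first by constructor 2.
  by have /orP[h|h] := Rtot x y; [constructor 1|constructor 3];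
    split=> // /esym.
have lt_wf : well_founded lt.
  move=> x; apply: contrapT => nx.
  have [|y ny ymin] := Rmin [set x | ~ Acc lt x]; first by exists x.
  apply: ny; constructor => z [zy nzy]; apply: contrapT => nz.
  by apply: nzy; apply: Ranti => //; exact: ymin.
have lt_irr x : ~ lt x x by move=> [].
pose big := [set a | P #<= [set b | lt b a]].
have [Q [QP Qdown Qsmall]] : exists Q : set (set_type P),
    [/\ P #<= Q, (forall a b, Q a -> lt b a -> Q b) &
        forall a, Q a -> ~ (P #<= [set b | lt b a])].
  have [/Rmin[a biga amin]|nbig] := pselect (big !=set0).
    exists [set b | lt b a]; split=> //= [b c ba cb|b ba Pb].
      exact: lt_tr cb ba.
    by apply: (lt_irr a); apply: (lt_tr _ b) => //; split;
      [exact: amin|move=> ab; apply: (lt_irr a); rewrite {1}ab].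
  exists setT; split=> //; last by move=> a _ Pa; apply: nbig; exists a.
  by have := card_setT P; rewrite card_eq_le => /andP[].
pose ltQ (x y : set_type Q) := lt (set_val x) (set_val y).
exists (set_type Q : choiceType), ltQ; split.
- have wfQ t : forall x : set_type Q, set_val x = t -> Acc ltQ x.
    elim: (lt_wf t) => {}t _ IH x xt; constructor => y yx.
    by apply: (IH (set_val y)); rewrite // -xt.
  by move=> x; exact: wfQ.
- by move=> a b c; exact: lt_tr.
- move=> a b; have [h|h|h] := lt_tot (set_val a) (set_val b).
  + by constructor 1.
  + by constructor 2; exact: val_inj.
  + by constructor 3.
- apply: (card_eq_trans (card_setT Q)); rewrite card_eq_le QP andbT.
  apply: card_le_trans (card_leT Q) _.
  by have := card_setT P; rewrite card_eq_le => /andP[].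
- move=> a Pa; apply: (Qsmall _ (set_valP a)); apply: card_le_trans Pa _.
  apply: (@card_le_inj _ _ _ _ set_val) => // x y _ _.
  exact: val_inj.
Qed.

(** * Pseudointersections *)

Lemma infinite_nat_gt (A : set nat) : infinite_set A ->
  forall m, exists2 x, A x & m < x.
Proof.
move=> Ainf m; apply: contrapT => nx; apply: Ainf.
apply: (sub_finite_set _ (finite_II m.+1)) => x Ax /=.
by rewrite ltnS leqNgt; apply/negP => mx; apply: nx; exists x.
Qed.

Lemma gt_infinite_nat (A : set nat) :
  (forall m, exists2 x, A x & m <= x) -> infinite_set A.
Proof.
move=> h /finite_seqP[X AX]; pose m := \max_(x <- X) x.
have [x Ax] := h m.+1; rewrite ltnNge => /negP; apply.
by apply: leq_bigmax_seq => //; move: Ax; rewrite AX.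
Qed.

Lemma finite_nat_bound (A : set nat) : finite_set A ->
  exists m, forall x, A x -> x < m.
Proof.
move=> /finite_seqP[X ->]; exists (\max_(x <- X) x).+1 => x xX.
by rewrite ltnS; exact: leq_bigmax_seq.
Qed.

Lemma pseudointersection_number_min (G : set (set nat)) :
  infinite_family G -> centered G -> ~ (exists A, pseudointersection G A) ->
  pseudointersection_number #<= G.
Proof.
move=> Ginf Gc Gn; have [|_] := @least_cardP _ [set G | [/\ infinite_family G,
    centered G & ~ exists A, pseudointersection G A]].
  by exists G.
by apply.
Qed.

(** Directedness makes the family centered and [pickle] carries it to subsets of [nat]; without a
    pseudointersection it would bound the cardinal p by the size of [D]. *)
Lemma few_pseudointersection (I : Type) (K : countType) (D : set I)
    (F : I -> set K) :
  ~ (pseudointersection_number #<= D) -> D !=set0 ->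
  (forall i, D i -> infinite_set (F i)) ->
  (forall i j, D i -> D j -> exists2 k, D k & F k `<=` F i `&` F j) ->
  exists A, infinite_set A /\ forall i, D i -> finite_set (A `\` F i).
Proof.
move=> Dfew [i0 Di0] Finf Fdir.
pose G := [set pickle @` F i | i in D].
have pinj (A : set K) : pickle @` A #= A.
  by apply: inj_card_eq => x y _ _; exact: (pcan_inj pickleK).
have [[A [Ainf AG]]|nA] := pselect (exists A, pseudointersection G A).
  (* Up to a finite set, [A] lies in the image of [F i0], hence in the range of [pickle]; so its
     preimage stays infinite. *)
  exists (pickle @^-1` A); split=> [fA|i Di].
    apply: Ainf; apply: (@sub_finite_set _ _
        (pickle @` (pickle @^-1` A) `|` (A `\` pickle @` F i0))).
      move=> n An; have [[x Fx xn]|nFn] := pselect ((pickle @` F i0) n).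
        by left; exists x => //=; rewrite xn.
      by right.
    rewrite finite_setU; split; first exact: finite_image.
    by apply: AG; exists i0.
  rewrite -(eq_finite_set (pinj _)); apply: sub_finite_set (AG (pickle @` F i) _).
    move=> _ [x [/= Ax nFx] <-]; split=> // -[y Fy] /(pcan_inj pickleK) yx.
    by apply: nFx; rewrite -yx.
  by exists i.
exfalso; apply: Dfew; apply: (@card_le_trans _ _ _ G); last exact: card_image_le.
apply: pseudointersection_number_min nA.
  by move=> _ [i Di <-]; rewrite (eq_finite_set (pinj _)); exact: Finf.
move=> n B BG; elim: n BG => [|n IH] BG.
  by exists (B 0) => [|i]; [exact: BG|rewrite leqn0 => /eqP ->].
have [|_ [i Di <-] iB] := IH; first by move=> i ile; apply: BG; exact: leqW.
have [j Dj jB] := BG n.+1 (leqnn _).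
have [k Dk kij] := Fdir i j Di Dj.
exists (pickle @` F k) => [|l]; first by exists k.
rewrite leq_eqVlt => /orP[/eqP ->|/iB liB] _ [x /kij[Fix Fjx] <-].
  by rewrite -jB; exists x.
by apply: liB; exists x.
Qed.

Section few.
Context (p_neq0 : pseudointersection_number !=set0).
Let p := pseudointersection_number.

(** Diagonal argument: along an enumeration [e] of the family, a strictly increasing sequence with
    [a n] in a member below the first [n.+1] sets would have a pseudointersection as its range. *)
Lemma pseudointersection_number_uncountable : ~ (p #<= [set: nat]).
Proof.
have [[pinf pc pn] _] : [set G | [/\ infinite_family G, centered G &
    ~ exists A, pseudointersection G A]] p /\
    forall H, [set G | [/\ infinite_family G, centered G &
    ~ exists A, pseudointersection G A]] H -> p #<= H.
  apply: least_cardP; apply: contrapT => /set0P/negP/negPn/eqP P0.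
  have [G] := p_neq0; rewrite /pseudointersection_number P0 /least_card.
  by case: xgetP => [H _ [[]]|].
move=> /(card_le_exsurj p_neq0)[e eP].
have p_e n : exists B, p B /\ forall i, i <= n -> p (e i) -> B `<=` e i.
  have [B0 pB0] := p_neq0.
  pose A i := if `[< p (e i) >] then e i else B0.
  have [|B pB BA] := pc n A; first by move=> i _; rewrite /A; case: asboolP.
  by exists B; split=> // i /BA; rewrite /A; case: asboolP.
have [B BP] := choice p_e.
have ex n m : exists x, B n x /\ m < x.
  by have [pB _] := BP n; have [x] := infinite_nat_gt (pinf _ pB) m; exists x.
have [c cP] := choice (fun q => ex q.1 q.2).
pose fix a n := c (n, if n is n'.+1 then a n' else 0).
have aB n : B n (a n).
  by case: n => [|n]; [case: (cP (0, 0))|case: (cP (n.+1, a n))].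
have alt n : a n < a n.+1 by have [] := cP (n.+1, a n).
have an n : n <= a n by elim: n => // n /leq_ltn_trans; exact.
apply: pn; exists (range a); split.
  by apply: gt_infinite_nat => m; exists (a m) => //; exists m.
move=> C pC; have [i _ ei] := eP _ pC.
apply: (@sub_finite_set _ _ (a @` `I_i)); last exact/finite_image/finite_II.
move=> _ [[n _ <-] nC]; exists n => //=; rewrite ltnNge; apply/negP => ile.
by apply: nC; have [_ /(_ i ile)] := BP n; rewrite ei => /(_ pC); apply.
Qed.

Lemma few_countable {T : Type} (Z : set T) : countable Z -> ~ (p #<= Z).
Proof.
move=> Zc pZ; apply: pseudointersection_number_uncountable.
exact: card_le_trans pZ Zc.
Qed.

Lemma few_setX_nat {T : Type} (Z : set T) : ~ (p #<= Z) ->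
  ~ (p #<= Z `*` [set: nat]).
Proof.
move=> Zfew; have [Zfin|Zinf] := pselect (finite_set Z).
  by apply: few_countable; apply: countableX => //; exact: finite_set_countable.
by move=> /card_le_trans/(_ (card_leX_nat Zinf)).
Qed.

End few.

(** * Nowhere dense sets and interval partitions *)

Lemma take_mkseq {T : Type} (f : nat -> T) m n :
  n <= m -> take n (mkseq f m) = mkseq f n.
Proof. by move=> /minn_idPl nm; rewrite /mkseq -map_take take_iota nm. Qed.

Definition cylinder {T : eqType} (t : seq T) : set (nat -> T) :=
  [set x | mkseq x (size t) = t].

(* The combinatorial form of "nowhere dense" in a power of a discrete space. *)
Definition rare {T : eqType} (F : set (nat -> T)) : Prop :=
  forall t, exists u, forall x, cylinder (t ++ u) x -> ~ F x.

Section rare_sets.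
Context {T : eqType}.
Implicit Types (F : set (nat -> T)) (t u : seq T) (x y : nat -> T).

Lemma cylinderP (d : T) t x :
  cylinder t x <-> forall i, i < size t -> x i = nth d t i.
Proof.
split=> [xt i it|h]; first by rewrite -[in RHS]xt nth_mkseq.
apply: (@eq_from_nth _ d); first by rewrite size_mkseq.
by move=> i; rewrite size_mkseq => it; rewrite nth_mkseq // h.
Qed.

Lemma cylinder_mkseq x y n :
  cylinder (mkseq x n) y <-> forall i, i < n -> y i = x i.
Proof.
rewrite (cylinderP (x 0)) size_mkseq.
by split=> h i it; have := h i it; rewrite nth_mkseq.
Qed.

Lemma cylinder_prefix t u : cylinder (t ++ u) `<=` cylinder t.
Proof.
case: t => [|d t] x; first by rewrite /cylinder /=.
rewrite !(cylinderP d) size_cat => h i it.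
by rewrite h ?nth_cat ?it // ltn_addr.
Qed.

Lemma cylinder_neq0 (d : T) t : cylinder t !=set0.
Proof.
exists (nth d t); rewrite /cylinder /=; apply: (@eq_from_nth _ d).
  by rewrite size_mkseq.
by move=> i; rewrite size_mkseq => ?; rewrite nth_mkseq.
Qed.

Lemma rare0 : rare (@set0 (nat -> T)).
Proof. by move=> t; exists [::] => x _ []. Qed.

Lemma rareU F G : rare F -> rare G -> rare (F `|` G).
Proof.
move=> rF rG t; have [u uF] := rF t; have [v vG] := rG (t ++ u).
exists (u ++ v) => x; rewrite catA => xuv [|]; last exact: vG.
exact/uF/(cylinder_prefix xuv).
Qed.

Lemma rare_bigcup_ltn (F : nat -> set (nat -> T)) n :
  (forall k, k < n -> rare (F k)) -> rare (\bigcup_(k in `I_n) F k).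
Proof.
elim: n => [|n IH] rF; first by rewrite II0 bigcup_set0; exact: rare0.
rewrite IIS bigcup_setU bigcup_set1; apply: rareU; last exact: rF.
by apply: IH => k kn; apply: rF; exact: ltnW.
Qed.

Lemma rare_avoid F (ts : seq (seq T)) : rare F ->
  exists s, forall t, t \in ts -> forall x, cylinder (t ++ s) x -> ~ F x.
Proof.
move=> rF; elim: ts => [|t ts [s sP]]; first by exists [::].
have [u uP] := rF (t ++ s); exists (s ++ u) => t'.
rewrite inE => /orP[/eqP ->|t'ts] x; rewrite catA; first exact: uP.
by move/cylinder_prefix; exact: sP.
Qed.

(* A single y and interval partition f serve all the sets F k at once. The
   last point of each interval is left free for later use. *)
Lemma rare_fusion (d : T) (E : T -> seq T) (F : nat -> set (nat -> T)) :
  (forall k, rare (F k)) ->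
  exists f y, (forall n : nat, f n < f n.+1) /\
    forall n k x, k <= n -> (forall i, i < f n -> x i \in E (y i)) ->
      (forall i, f n <= i -> i.+1 < f n.+1 -> x i = y i) -> ~ F k x.
Proof.
move=> rF.
(* [S w] lists the words that at each place take a letter allowed by [E] at the letter of [w]. It is
   a finite list, so a single suffix can serve all of them. *)
pose S := foldr (fun a L => [seq b :: t | b <- E a, t <- L]) [:: [::]].
have SP w t : size t = size w ->
    (forall i, i < size w -> nth d t i \in E (nth d w i)) -> t \in S w.
  elim: w t => [|a w IH] [|b t] //= [tw] h; apply: allpairs_f.
    exact: (h 0).
  by apply: IH => // i; exact: (h i.+1).
have ex q : exists s, forall t, t \in S q.2 -> forall x,
    cylinder (t ++ s) x -> ~ (\bigcup_(k in `I_q.1.+1) F k) x.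
  by apply: rare_avoid; apply: rare_bigcup_ltn.
have [nx nxP] := choice ex.
(* Each stage appends a suffix serving every word of [S (ws n')], then the letter [d] at the free
   last point of the interval. *)
pose fix ws n := if n is n'.+1 then
  ws n' ++ rcons (nx (n', ws n')) d else [::].
have wsS n : size (ws n.+1) = (size (ws n) + size (nx (n, ws n))).+1.
  by rewrite /= size_cat size_rcons addnS.
have ws_size n : n <= size (ws n).
  by elim: n => // n IH; rewrite wsS ltnS (leq_trans IH) // leq_addr.
have ws_nth m n i : m <= n -> i < size (ws m) -> nth d (ws n) i = nth d (ws m) i.
  move=> /subnK <-; elim: (n - m) => // k IH im; rewrite -[RHS]IH //= nth_cat.
  suff -> : i < size (ws (k + m)) by [].
  by elim: {IH} k => // k; rewrite addSn wsS ltnS => /ltnW /leq_trans; apply;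
    exact: leq_addr.
pose y i := nth d (ws i.+1) i.
have yE n i : i < size (ws n) -> y i = nth d (ws n) i.
  move=> iw; rewrite /y; have [/ws_nth ->//|/ltnW/ws_nth ->//] := leqP n i.+1.
exists (fun n => size (ws n)), y; split=> [n|n k x kn xE xy].
  by rewrite wsS ltnS leq_addr.
move=> Fkx; have := nxP (n, ws n) (mkseq x (size (ws n))); apply.
- apply: SP => [|i iw]; first by rewrite size_mkseq.
  by rewrite nth_mkseq //= -yE //; exact: xE.
- rewrite (cylinderP d) size_cat size_mkseq => i iw; rewrite nth_cat size_mkseq.
  case: ltnP => wi; first by rewrite nth_mkseq.
  have iS : i.+1 < size (ws n.+1) by rewrite wsS ltnS.
  rewrite xy // (yE n.+1) ?(ltnW iS) //= nth_cat ltnNge wi /= nth_rcons.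
  suff -> : i - size (ws n) < size (nx (n, ws n)) by [].
  by rewrite ltn_subLR.
- by exists k.
Qed.

End rare_sets.

(** In applications the extension is a modified point rather than a suffix; the maximum with
    [size t] ensures that its restriction extends [t]. *)
Lemma rareI {T : eqType} (d : T) (F : set (nat -> T)) :
  (forall z n, exists z' m, (forall i, i < n -> z' i = z i) /\
     forall x, (forall i, i < m -> x i = z' i) -> ~ F x) ->
  rare F.
Proof.
move=> h t; have [z' [m [zt zF]]] := h (nth d t) (size t).
exists (drop (size t) (mkseq z' (maxn m (size t)))) => x xt; apply: zF => i im.
suff tE : t ++ drop (size t) (mkseq z' (maxn m (size t))) =
    mkseq z' (maxn m (size t)).
  by move: xt; rewrite tE => /cylinder_mkseq; apply; rewrite leq_max im.
rewrite -[RHS](cat_take_drop (size t)); congr (_ ++ _).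
rewrite take_mkseq; last by rewrite leq_maxr.
by apply: (@eq_from_nth _ d) => [|j jt]; rewrite ?size_mkseq // nth_mkseq ?zt.
Qed.

Lemma rareE {T : eqType} (F : set (nat -> T)) : rare F ->
  forall z n, exists z' m, (forall i, i < n -> z' i = z i) /\
     forall x, (forall i, i < m -> x i = z' i) -> ~ F x.
Proof.
move=> rF z n; have [u uF] := rF (mkseq z n); pose t := mkseq z n ++ u.
have tn : size (mkseq z n) = n by rewrite size_mkseq.
exists (nth (z 0) t), (size t); split=> [i im|x xt].
  by rewrite nth_cat tn im nth_mkseq.
by apply: uF; apply/(cylinderP (z 0)).
Qed.

(** * Meager sets of Baire space and matching on intervals *)

Lemma baire_nbhsP (x : baire_space) (U : set baire_space) :
  nbhs x U <-> exists n, cylinder (mkseq x n) `<=` U.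
Proof.
split=> [xU|[n nU]].
  pose F := filter_from [set: nat]
    (fun n => cylinder (mkseq x n) : set baire_space).
  have FF : Filter F.
    apply: filter_from_filter; first by exists 0.
    move=> m n _ _; exists (maxn m n) => // y /cylinder_mkseq yx.
    by split; apply/cylinder_mkseq => i im; apply: yx; rewrite leq_max im ?orbT.
  suff : {ptws, F --> x} by move=> /(_ _ xU)[n _ nU]; exists n.
  apply/(@pointwise_cvgP nat nat) => i V /nbhs_singleton Vx.
  exists i.+1 => // y /cylinder_mkseq yx.
  by rewrite /= yx.
apply: filterS nU _; elim: n => [|n IH].
  by apply: filterS filterT => y _; apply/cylinder_mkseq.
have /= := @proj_continuous nat (fun=> nat) n x.
move=> /(_ [set x n]) h.
apply: (filterS _ (filterI IH (h _))).
  move=> y [/cylinder_mkseq yx yn]; apply/cylinder_mkseq => i.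
  by rewrite ltnS leq_eqVlt => /orP[/eqP ->|/yx].
exact: discrete_set1.
Qed.

Lemma nowhere_denseP (F : set baire_space) : nowhere_dense F <-> rare F.
Proof.
split=> [F0 t|rF].
  apply: contrapT => nt; have [x xt] := cylinder_neq0 0 t.
  suff : interior (closure F) x by rewrite F0.
  apply/baire_nbhsP; exists (size t); rewrite xt => y yt B.
  move=> /baire_nbhsP[n nB]; pose m := maxn n (size t).
  have [z Fz yz] : exists2 z, F z & cylinder (mkseq y m) z.
    apply: contrapT => nz; apply: nt; exists (drop (size t) (mkseq y m)) => z.
    rewrite -[X in X ++ _]yt -(take_mkseq y (leq_maxr n (size t))) cat_take_drop.
    by move=> yz Fz; apply: nz; exists z.
  exists z; split=> //; apply: nB; move: yz => /cylinder_mkseq yz.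
  by apply/cylinder_mkseq => i im; apply: yz; rewrite leq_max im.
apply/seteqP; split=> // x /baire_nbhsP[n nF].
have [x' [m [xx' x'F]]] := rareE rF x n.
have x'c : closure F x' by apply: nF; apply/cylinder_mkseq.
have [|z [Fz]] := x'c (cylinder (mkseq x' m)); first by apply/baire_nbhsP; exists m.
by move=> /cylinder_mkseq/x'F.
Qed.

Definition increasing (f : nat -> nat) : Prop := forall n, f n < f n.+1.

Lemma increasing_leq f : increasing f -> {mono f : m n / m <= n}.
Proof. by move=> fi; apply: leq_mono; apply: homo_ltn => //; exact: ltn_trans. Qed.

Lemma increasing_ltn f : increasing f -> {mono f : m n / m < n}.
Proof. by move=> /increasing_leq/leqW_mono. Qed.

Lemma increasing_ge f n : increasing f -> n <= f n.
Proof. by move=> fi; elim: n => // n /leq_ltn_trans; apply. Qed.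

(* Only the parity of the values of x is compared with y, so that points of
   Baire space can be matched against points of the Cantor space. *)
Definition mismatch (f : nat -> nat) (y : nat -> bool) (m : nat) :
    set (nat -> nat) :=
  [set x | forall k, m <= k -> exists2 i, f k <= i < f k.+1 & odd (x i) != y i].

(** A condition of length [n] can be continued by [y] through an interval [k] with [m <= k] and
    [n <= k], which then contains no disagreement. *)
Lemma mismatch_meager f y : increasing f ->
  @meager baire_space (\bigcup_m mismatch f y m).
Proof.
move=> fi; exists (mismatch f y) => // m; apply/nowhere_denseP.
apply: (rareI 0) => z n; pose k := maxn m n.
exists (fun i => if i < n then z i else y i), (f k.+1); split=> [i ->//|x xz xm].
have [|i /andP[ki ik]] := xm k; first exact: leq_maxl.
rewrite xz // ltnNge; suff -> : n <= i by rewrite oddb eqxx.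
by apply: leq_trans ki; apply: leq_trans (increasing_ge _ fi); exact: leq_maxr.
Qed.

(* A block on which no interval of f agrees with y is bad. If there were
   infinitely many bad blocks, a point following w there and disagreeing with y
   elsewhere would be a mismatch outside M. *)
Lemma meager_block (M : set baire_space) : meager M ->
  exists f' (y' : nat -> bool), increasing f' /\
    forall f y, increasing f -> \bigcup_m mismatch f y m `<=` M ->
      exists m, forall n, m <= n ->
        exists k, [/\ f' n <= f k, f k.+1 <= f' n.+1 &
          forall i, f k <= i < f k.+1 -> y' i = y i].
Proof.
move=> [F Fnd ->].
(* The values [0] and [1] allow a disagreement with either bit of [y], and [a] allows the point to
   follow [w]. *)
have [|f' [w [f'i wF]]] := rare_fusion 0 (fun a => [:: 0; 1; a]) (F := F).
  by move=> k; apply/nowhere_denseP.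
exists f', (odd \o w); split=> // f y fi MF.
pose bad n := ~ exists k, [/\ f' n <= f k, f k.+1 <= f' n.+1 &
  forall i, f k <= i < f k.+1 -> (odd \o w) i = y i].
apply: contrapT => nm.
have badinf m : exists2 n, m <= n & bad n.
  apply: contrapT => nb; apply: nm; exists m => n mn; apply: contrapT => bn.
  by apply: nb; exists n.
pose blk n i := f' n <= i < (f' n.+1).-1.
pose x i := if `[< exists2 n, bad n & blk n i >] then w i else ~~ y i.
have xin n i : bad n -> blk n i -> x i = w i.
  by move=> bn ni; rewrite /x; case: asboolP => // -[]; exists n.
have xout i : (forall n, bad n -> ~ blk n i) -> odd (x i) != y i.
  move=> ni; rewrite /x; case: asboolP => [[n bn ni']|_]; first by case: (ni n).
  by rewrite oddb; case: (y i).
have xM : (\bigcup_m mismatch f y m) x.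
  exists 0 => // k _; apply: contrapT => nx.
  have [[n bn kn]|nn] := pselect (exists2 n, bad n & blk n (f k)); last first.
    apply: nx; exists (f k); first by rewrite leqnn fi.
    by apply: xout => n bn kn; apply: nn; exists n.
  have /andP[nk kn'] := kn.
  have [le|gt] := leqP (f k.+1) (f' n.+1).-1.
    apply: (bn); exists k; split=> //; first exact: leq_trans le (leq_pred _).
    move=> i ik; apply/eqP; apply: contrapT => /negP nxi; apply: nx; exists i => //.
    move/andP: ik => [ki ik]; rewrite (xin n) //; last first.
      by rewrite /blk (leq_trans nk ki) (leq_trans ik le).
  (* The interval overruns the block, so it contains the last point of the block. This point is in
     no [blk l], hence [x] disagrees with [y] there. *)
  apply: nx; exists (f' n.+1).-1; first by rewrite gt (ltnW kn').
  have f'gt0 j : 0 < f' j.+1 by rewrite (leq_ltn_trans _ (f'i j)).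
  apply: xout => l _ /andP[ln nl].
  have : l < n.+1 by rewrite -(increasing_ltn f'i) -(prednK (f'gt0 n)) ltnS.
  suff : n.+1 < l.+1 by rewrite !ltnS ltnNge => /negP.
  by rewrite -(increasing_ltn f'i) -(prednK (f'gt0 n)) -(prednK (f'gt0 l)) ltnS.
(* The contradiction: [x] lies in [F k] but follows [w] on a bad block of index at least [k]. *)
have [k _ Fkx] := MF _ xM; have [n kn bn] := badinf k.
apply: (wF n k x) => // i => [_|ni iS].
  by rewrite /x !inE; case: asboolP => _; [rewrite eqxx !orbT|case: (y i)].
apply: (xin n) => //; rewrite /blk ni /=.
by rewrite -ltnS prednK // (leq_ltn_trans _ (f'i n)).
Qed.

(** Fusion turns [D] into a pair [f], [y]. A member [M] of [C] containing the mismatches with this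
    pair determines, through [meager_block], enough of [y] to bound almost all [D n] by sets that
    depend on [M] only. *)
Lemma cofinal_rare_sequences (C : set (set baire_space)) : cofinal_meager C ->
  exists N : set baire_space -> nat -> set (nat -> bool),
    (forall M n, rare (N M n)) /\
    forall D, (forall n, rare (D n)) ->
      exists2 M, C M & exists m, forall n, m <= n -> D n `<=` N M n.
Proof.
move=> [Cm Ccof].
have ex (M : set baire_space) :
    exists fy : (nat -> nat) * (nat -> bool), increasing fy.1 /\
    (meager M -> forall f y, increasing f -> \bigcup_m mismatch f y m `<=` M ->
      exists m, forall n, m <= n ->
        exists k, [/\ fy.1 n <= f k, f k.+1 <= fy.1 n.+1 &
          forall i, f k <= i < f k.+1 -> fy.2 i = y i]).
  have [/meager_block[f [y [fi fyP]]]|nM] := pselect (meager M).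
    by exists (f, y).
  by exists (id, xpred0); split.
have [fy fyP] := choice ex.
(* The bound n.*2 absorbs the shift between the two interval partitions. *)
pose N M n := [set z : nat -> bool | forall k, n.*2 <= k ->
  exists2 i, (fy M).1 k <= i < (fy M).1 k.+1 & z i != (fy M).2 i].
exists N; split=> [M n|D rD].
  have [f'i _] := fyP M; apply: (rareI false) => z l; pose k := maxn n.*2 l.
  exists (fun i => if i < l then z i else (fy M).2 i), ((fy M).1 k.+1).
  split=> [i ->//|x xz /(_ k (leq_maxl _ _))[i /andP[ki ik]]].
  rewrite xz // ltnNge; suff -> : l <= i by rewrite eqxx.
  by apply: leq_trans ki; apply: leq_trans (increasing_ge _ f'i); exact: leq_maxr.
have [f [y [fi fyD]]] := rare_fusion false (fun=> [:: false; true]) rD.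
have [M CM MM] := Ccof _ (mismatch_meager y fi).
exists M => //; have [f'i /(_ (Cm _ CM) _ _ fi MM)[m mP]] := fyP M.
(* Successive blocks contain distinct intervals of [f], so the one in block [m + j] has index at
   least [j]. For [j = k - m], with [n.*2 <= k] and [m <= n], the index is at least [n], as the
   fusion for [D n] requires. *)
have mPj j : exists k, [/\ j <= k, (fy M).1 (m + j) <= f k,
    f k.+1 <= (fy M).1 (m + j).+1 &
    forall i, f k <= i < f k.+1 -> (fy M).2 i = y i].
  elim: j => [|j [k [jk _ kj _]]].
    by have [|k [? ? ?]] := mP (m + 0); [rewrite addn0|exists k].
  have [|l [fl lf ly]] := mP (m + j.+1); first exact: leq_addr.
  exists l; split=> //; apply: leq_ltn_trans jk _.
  by rewrite -(increasing_leq fi) (leq_trans kj) // -addnS.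
exists m => n mn z Dz k nk.
have [l [nl fl lf ly]] := mPj (k - m).
have mk : m <= k by rewrite (leq_trans mn) // (leq_trans _ nk) // -addnn leq_addr.
rewrite subnKC // in fl lf.
have {}nl : n <= l.
  apply: leq_trans nl; rewrite leq_subRL // (leq_trans _ nk) // -addnn.
  by rewrite leq_add2r.
apply: contrapT => nz; apply: (fyD l n z nl) => // [i _|i li il].
  by rewrite !inE; case: (z i).
apply/eqP; apply: contrapT => /negP zi; apply: nz.
have {}il := ltnW il.
exists i; last by rewrite ly // li.
by rewrite (leq_trans fl li) (leq_trans il lf).
Qed.

(** * Towers *)

Section order.
Context {J : choiceType} (lt : J -> J -> Prop).

(* None stands for a bottom element added to J. *)
Definition below (b : option J) (a : J) : Prop :=
  if b is Some b' then lt b' a else True.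

Lemma card_below_le (j0 : J) a :
  [set q : option J * nat | below q.1 a] #<=
  ([set: J] `*` [set: nat]) `*` [set: nat].
Proof.
(* The first number is a flag: [0] codes the bottom element [None]. *)
apply: (@card_le_surj _ _ _ _
  (fun p => (if p.1.2 is 0 then None else Some p.1.1, p.2))).
by move=> [[b|] m] _; [exists ((b, 1), m)|exists ((j0, 0), m)].
Qed.

Lemma few_below a : pseudointersection_number !=set0 ->
  ~ (pseudointersection_number #<= [set b | lt b a]) ->
  ~ (pseudointersection_number #<= [set q : option J * nat | below q.1 a]).
Proof.
move=> p0 afew; have [[c ca]|nc] := pselect (exists c, lt c a).
  have := few_setX_nat p0 (few_setX_nat p0 afew) => h pD; apply: h.
  apply: card_le_trans pD _; apply: (@card_le_surj _ _ _ _
    (fun p => (if p.1.2 is 0 then None else Some p.1.1, p.2))).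
  by move=> [[b|] m] /= ba; [exists ((b, 1), m)|exists ((c, 0), m)].
apply: few_countable => //; apply: (@card_le_surj _ _ _ _ (fun m => (None, m))).
by move=> [[b|] m] /= ba; [exfalso; apply: nc; exists b|exists m].
Qed.

(** [O a n] is the trace of [O a] on slice [n]; clopenness in the Cantor set is expressed as
    dependence on finitely many coordinates. *)
Record tower (O : J -> nat -> set (nat -> bool)) : Prop := Tower {
  tower_clopen : forall a n, exists k, forall z z',
    (forall i, i < k -> z' i = z i) -> O a n z -> O a n z';
  tower_decreasing : forall b a, lt b a ->
    exists m, forall n, m <= n -> O a n `<=` O b n;
  tower_infinite : forall a m, exists2 n, m <= n & O a n !=set0 }.

End order.

(** At most one cylinder per slice suffices for the tower, and this form makes its members clopen
    automatically. *)
Definition slot (s : nat -> option (seq bool)) (n : nat) : set (nat -> bool) :=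
  if s n is Some t then cylinder t else set0.

Lemma slot_neq0 s n : slot s n !=set0 ->
  exists2 t, s n = Some t & slot s n = cylinder t.
Proof.
by rewrite /slot; case: (s n) => [t|[]//]; exists t.
Qed.

Lemma slot_clopen s n : exists k, forall z z',
  (forall i, i < k -> z' i = z i) -> slot s n z -> slot s n z'.
Proof.
rewrite /slot; case: (s n) => [t|]; last by exists 0.
exists (size t) => z z' zz' /(cylinderP false) zt.
by apply/(cylinderP false) => i it; rewrite zz' // zt.
Qed.

Lemma tower_exists {J : choiceType} (lt : J -> J -> Prop)
    (N : J -> nat -> set (nat -> bool)) :
  well_founded lt -> (forall a b c, lt a b -> lt b c -> lt a c) ->
  (forall a b, [\/ lt a b, a = b | lt b a]) ->
  pseudointersection_number !=set0 ->
  (forall a, ~ (pseudointersection_number #<= [set b | lt b a])) ->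
  (forall a n, rare (N a n)) ->
  exists2 O, tower lt O & forall a n z, O a n z -> ~ N a n z.
Proof.
move=> lt_wf lt_tr lt_tot p0 afew rN.
pose good a (f : forall b, lt b a -> nat -> option (seq bool)) :=
  [set s | [/\ forall b ba, exists m, forall n, m <= n ->
                 slot s n `<=` slot (f b ba) n,
               forall m, exists2 n, m <= n & slot s n !=set0 &
               forall n z, slot s n z -> ~ N a n z]].
(* Recursion by choice: the default [fun=> None] is never taken, since [sgood] shows by induction
   that a good code exists. *)
pose step a f := xget (fun=> None) (good a f).
pose s := Fix lt_wf (fun=> nat -> option (seq bool)) step.
have sE a : s a = step a (fun b _ => s b).
  rewrite /s Fix_eq // => b f g fg; congr (step b _).
  by apply: functional_extensionality_dep => c;
     apply: functional_extensionality_dep => cb.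
suff sgood a : good a (fun b _ => s b) (s a).
  exists (fun a => slot (s a)); last by move=> a; have [] := sgood a.
  split=> [a n|b a ba|a]; first exact: slot_clopen.
    by have [/(_ b ba)] := sgood a.
  by have [] := sgood a.
(* A pseudointersection of the sets F q provides, in infinitely many slices, a
   cylinder that avoids N a and lies in every earlier O b with finitely many
   exceptions. *)
elim: (lt_wf a) => {}a _ IH; rewrite [s a]sE /step.
apply: xgetPex.
pose O b n := if b is Some b' then slot (s b') n else setT.
pose F (q : option J * nat) := [set nt : nat * seq bool |
  [/\ q.2 <= nt.1, cylinder nt.2 `<=` O q.1 nt.1 &
      forall z, cylinder nt.2 z -> ~ N a nt.1 z]].
pose D := [set q : option J * nat | below lt q.1 a].
have Oinf b m : below lt b a -> exists n t, m <= n /\ cylinder t `<=` O b n.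
  case: b => [b|] /= ba; last by exists m, [::].
  have [_ /(_ m)[n mn /slot_neq0[t _ st]] _] := IH b ba.
  by exists n, t; split=> //=; rewrite st.
have ODec b c : below lt b a -> below lt c a ->
    exists d m, below lt d a /\ forall n, m <= n -> O d n `<=` O b n `&` O c n.
  case: b c => [b|] [c|] /= ba ca.
  - have [bc|<-|cb] := lt_tot b c.
    + have [/(_ b bc)[m mP] _ _] := IH c ca; exists (Some c), m; split => // n mn.
      by rewrite subsetI; split=> //; exact: mP.
    + by exists (Some b), 0; split => // n _; rewrite setIid.
    + have [/(_ c cb)[m mP] _ _] := IH b ba; exists (Some b), m; split => // n mn.
      by rewrite subsetI; split=> //; exact: mP.
  - by exists (Some b), 0; split => // n _; rewrite setIT.
  - by exists (Some c), 0; split => // n _; rewrite setTI.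
  - by exists None, 0; split => // n _; rewrite setTI.
have [| | | |A [Ainf AF]] := @few_pseudointersection _ _ D F.
- exact: few_below.
- by exists (None, 0); rewrite /D /=.
- move=> [b m] /= ba fF.
  have /gt_infinite_nat : forall l, exists2 n, (fst @` F (b, m)) n & l <= n.
    move=> l; have [n [t [ln tO]]] := Oinf b (maxn l m) ba.
    have [u uN] := rN a n t; exists n; last by rewrite (leq_trans _ ln) ?leq_maxl.
    exists (n, t ++ u) => //; split=> //=.
      by rewrite (leq_trans _ ln) ?leq_maxr.
    by move=> z /cylinder_prefix; exact: tO.
  by apply; exact: finite_image.
- move=> [b m] [c l] /= ba ca; have [d [k [da dP]]] := ODec b c ba ca.
  exists (d, maxn k (maxn m l)) => // -[n t] [/=].
  rewrite !geq_max => /and3P[kn mn ln] tO tN.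
  by split; split=> //= z /tO /(dP n kn) [].
(* The finitely many members of [A] outside [F q] involve finitely many slices. *)
have Abound q : D q -> exists m, forall n t, A (n, t) -> m <= n -> F q (n, t).
  move=> Dq; have [m mP] := finite_nat_bound (finite_image fst (AF q Dq)).
  exists m => n t Ant mn; apply: contrapT => nF.
  have /mP : (fst @` (A `\` F q)) n by exists (n, t).
  by rewrite ltnNge mn.
have D0 m : D (None, m) by rewrite /D /=.
(* Discarding the members of [A] outside [F (None, 0)] makes the new set avoid [N a] on every slice,
   not just on almost all. *)
pose A0 n := [set t | A (n, t) /\ F (None, 0) (n, t)].
exists (fun n => if `[< A0 n !=set0 >] then Some (xget [::] (A0 n)) else None).
have slotE n z : slot (fun n => if `[< A0 n !=set0 >] then
    Some (xget [::] (A0 n)) else None) n z ->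
    exists2 t, A0 n t & cylinder t z.
  rewrite /slot; case: asboolP => [A0n|_ []] zt.
  by exists (xget [::] (A0 n)) => //; apply: xgetPex.
split=> [b ba|m|n z].
- have [|m mP] := Abound (Some b, 0) => //; exists m => n mn z.
  by move=> /slotE[t [At _] zt]; have [_ tO _] := mP n t At mn; exact: tO zt.
- have [[n t] [Ant Fnt]] : exists q, A q /\ (F (None, 0) `&` F (None, m)) q.
    apply: contrapT => nA; apply: Ainf.
    have : finite_set ((A `\` F (None, 0)) `|` (A `\` F (None, m))).
      by rewrite finite_setU; split; exact: AF.
    apply: sub_finite_set => q Aq; apply: contrapT => nq.
    apply: nA; exists q; split=> //.
    by split; apply: contrapT => ?; apply: nq; [left|right].
  exists n; first by have [_ []] := Fnt.
  rewrite /slot; case: asboolP => [_|]; first exact: (cylinder_neq0 false).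
  by case; exists t; split=> //; have [] := Fnt.
- by move=> /slotE[t [_ [_ _ tN]] /tN].
Qed.

(** * The space attached to a tower *)

Section topological_facts.
Context {X : topologicalType}.
Implicit Types (D U V : set X) (x d : X).

Lemma discrete_subsetP D : discrete_subset D <->
  forall d, D d -> exists V, open_nbhs d V /\ V `&` D `<=` [set d].
Proof.
split=> [Dd d Dx|h U].
  have [V Vo VE] := Dd [set SigSub (mem_set Dx)].
  have Vd d' (Dd' : D d') : V d' <-> d' = d.
    have : (set_val @^-1` V) (SigSub (mem_set Dd')) <->
        [set SigSub (mem_set Dx)] (SigSub (mem_set Dd')) by rewrite VE.
    move=> [h1 h2]; split=> [/h1 /(congr1 set_val)//|d'd]; apply: h2.
    exact: val_inj.
  exists V; split; first by split => //; exact/Vd.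
  by move=> d' [Vd' Dd']; exact/Vd.
exists (\bigcup_(V in [set V | open V /\ exists2 d, U d &
    V (set_val d) /\ V `&` D `<=` [set set_val d]]) V).
  by apply: bigcup_open => V [].
apply/seteqP; split=> [d [V [_ [d' Ud' [_ VD]]] Vd]|d Ud].
  suff /val_inj -> : set_val d = set_val d' by [].
  by apply: VD; split=> //; exact: set_valP.
have [V [[Vo Vd] VD]] := h _ (set_valP d).
by exists V => //; split => //; exists d.
Qed.

Lemma open_finite_setC (S : set X) : hausdorff_space X -> finite_set S ->
  open (~` S).
Proof.
move=> hX Sfin; apply: closed_openC.
by have [+ _] := @accessible_finite_set_closed X; apply => //;
  exact: hausdorff_accessible.
Qed.

(* Since the local base has fewer than p members, a pseudointersection selects
   from the countable range of e a sequence converging to x. *)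
Lemma discrete_of_countable (e : nat -> X) x (B : set (set X)) :
  hausdorff_space X -> local_base x B ->
  ~ (pseudointersection_number #<= B) ->
  closure (range e) x -> ~ range e x ->
  exists D, [/\ D `<=` range e, discrete_subset D & closure D x].
Proof.
move=> hX [Bx Bbase] Bfew ex nex.
have einf U : open_nbhs x U -> infinite_set (e @^-1` U).
  move=> [Uo Ux] fU; have Wo := open_finite_setC hX (finite_image e fU).
  have [|_ [[i _ <-] [Ui nW]]] := ex (U `&` ~` (e @` (e @^-1` U))).
    apply: open_nbhs_nbhs; split; first exact: openI.
    by split=> // -[i _ ei]; apply: nex; exists i.
  by apply: nW; exists i.
have [||U V BU BV|A [Ainf AB]] :=
    @few_pseudointersection _ nat B (fun U => e @^-1` U) Bfew.
- by have [V BV] := Bbase setT (conj openT I); exists V.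
- by move=> U /Bx; exact: einf.
- have [Uo Ux] := Bx _ BU; have [Vo Vx] := Bx _ BV.
  have [W BW WUV] := Bbase (U `&` V) (conj (openI Uo Vo) (conj Ux Vx)).
  by exists W => // i /WUV.
have AU U : open_nbhs x U -> finite_set (A `\` e @^-1` U).
  move=> /Bbase[V BV VU]; apply: sub_finite_set (AB V BV) => i [Ai nUi].
  by split=> // Vi; apply: nUi; exact: VU.
exists (e @` A); split; first by move=> _ [i _ <-]; exists i.
  apply/discrete_subsetP => d [i Ai eid].
  have xd : x != d by apply/eqP => xd; apply: nex; rewrite xd -eid; exists i.
  move: (hX); rewrite open_hausdorff => /(_ _ _ xd)[[U V] /=].
  move=> [/set_mem Ux /set_mem Vd].
  move=> [Uo Vo /eqP UV].
  (* [V] meets the sequence only in terms outside [U], of which there are finitely many; removing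
     those other than [d] isolates [d]. *)
  pose S := e @` (A `\` e @^-1` U) `\ d.
  have So : open (~` S).
    apply: open_finite_setC => //; apply: finite_setD.
    exact/finite_image/AU.
  exists (V `&` ~` S); split; first by split; [exact: openI|split => // -[_ []]].
  move=> y [[Vy nS] [j Aj ejy]]; apply: contrapT => yd; apply: nS.
  split=> //; exists j => //; split=> // Uj.
  have : (U `&` V) y by split=> //; rewrite -ejy.
  by rewrite UV.
move=> U; rewrite nbhsE => -[V xV VU].
have [i [Ai Vi]] : exists i, A i /\ V (e i).
  apply: contrapT => nV; apply: Ainf; apply: sub_finite_set (AU V xV) => i Ai.
  by split=> // Vi; apply: nV; exists i.
by exists (e i); split; [exists i|exact: VU].
Qed.

(** Near-covering compactness, applied to the filter generated by the sets of indices [j] with [W j]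
    above a given [W i], yields one index for all of [C]. *)
Lemma compact_directed_cover {I : Type} (i0 : I) (W : I -> set X) (C : set X) :
  compact C -> (forall i, open (W i)) ->
  (forall i j, exists k, W i `|` W j `<=` W k) ->
  (forall x, exists i, W i x) -> exists i, C `<=` W i.
Proof.
move=> Cc Wo Wdir Wcov.
pose F := filter_from [set: I] (fun i => [set j | W i `<=` W j]).
have FF : ProperFilter F.
  apply: filter_from_proper; last by move=> i _; exists i.
  apply: filter_from_filter; first by exists i0.
  move=> i j _ _; have [k ijk] := Wdir i j; exists k => // l kl.
  by split=> x Wx; apply: kl; apply: ijk; [left|right].
have /compact_near_coveringP := Cc.
move=> /(_ I F (fun i x => W i x) _)[].
  move=> x _; have [i Wx] := Wcov x.
  exists (W i, [set j | W i `<=` W j]) => [/=|[y j] /= [Wy Wij]];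
    last exact: Wij.
  by split; [exact: open_nbhs_nbhs|exists i].
by move=> i _ h; exists i; exact: h.
Qed.

End topological_facts.

Record ordinal_tower {J : choiceType} (lt : J -> J -> Prop)
    (O : J -> nat -> set (nat -> bool)) : Prop := OrdinalTower {
  ot_wf : well_founded lt;
  ot_trans : forall a b c, lt a b -> lt b c -> lt a c;
  ot_total : forall a b, [\/ lt a b, a = b | lt b a];
  ot_tower : tower lt O }.

Inductive tower_point (J : Type) : Type :=
  | Cpt of nat & (nat -> bool)
  | Lim of J.
Arguments Cpt {J}.

(* The analogue of the Franklin-Rajagopalan space with the points of omega
   blown up to Cantor sets: the sets hull a become compact and open, and are the
   one-point compactifications of the part of the space below Lim a that lies
   off O a. *)
Definition tower_space {J : choiceType} {lt : J -> J -> Prop}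
  {O : J -> nat -> set (nat -> bool)} of ordinal_tower lt O : Type :=
  tower_point J.

Section tower_space.
Context {J : choiceType} {lt : J -> J -> Prop}.
Context {O : J -> nat -> set (nat -> bool)} (OT : ordinal_tower lt O).
Local Notation X := (tower_space OT).

Let lt_trans := ot_trans OT.
Let lt_total := ot_total OT.

HB.instance Definition _ := gen_eqMixin X.
HB.instance Definition _ := gen_choiceMixin X.

Definition hull (a : J) : set X := fun p =>
  match p with Cpt n z => ~ O a n z | Lim c => lt c a \/ c = a end.

Definition initial_slices (m : nat) : set X := fun p =>
  if p is Cpt n _ then n < m else False.

Definition ohull (b : option J) : set X :=
  if b is Some b' then hull b' else set0.

(** Neighbourhoods of infinity in the one-point compactification that [hull a] is meant to be: a
    smaller hull (none for [None]) and finitely many slices are removed. *)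
Definition lim_base (a : J) (q : option J * nat) : set X :=
  hull a `\` (ohull q.1 `|` initial_slices q.2).

Definition cpt_base (n : nat) (z : nat -> bool) (k : nat) : set X := fun p =>
  if p is Cpt n' z' then n' = n /\ forall i, i < k -> z' i = z i else False.

Definition tower_open (U : set X) : Prop := forall p, U p ->
  match p with
  | Cpt n z => exists k, cpt_base n z k `<=` U
  | Lim a => exists2 q, below lt q.1 a & lim_base a q `<=` U
  end.

Lemma lt_irr a : ~ lt a a.
Proof. by elim: (ot_wf OT a) => {}a _ IH aa; exact: (IH _ aa). Qed.

(** From slice [l] on, [O c] lies in [O b], so there [hull b] lies in [hull c]; the earlier slices
    are removed. *)
Lemma lim_base_mono a b c m : lt b c -> exists l,
  lim_base a (Some c, maxn m l) `<=` lim_base a (Some b, m).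
Proof.
move=> bc; have [l lP] := tower_decreasing (ot_tower OT) bc.
exists l => -[n z|d] /= [ha nh]; split=> // -[hb|nm]; apply: nh.
- have [nm|mn] := ltnP n (maxn m l); first by right.
  left=> Oc; apply: hb; apply: lP Oc.
  by rewrite (leq_trans _ mn) // leq_maxr.
- by right; rewrite /= (leq_trans nm) // leq_maxl.
- left; left; case: hb => [db|->//]; exact: lt_trans db bc.
- by case: nm.
Qed.

Lemma lim_base_maxn a b m l :
  lim_base a (b, maxn m l) `<=` lim_base a (b, m) `&` lim_base a (b, l).
Proof.
move=> p [ha nh]; split; split=> // -[hb|hm]; apply: nh;
  [by left|right|by left|right].
  by case: p hm {ha} => //= n _ nm; rewrite leq_max nm.
by case: p hm {ha} => //= n _ nm; rewrite leq_max nm orbT.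
Qed.

Lemma lim_base_dir a q r : below lt q.1 a -> below lt r.1 a ->
  exists2 s, below lt s.1 a &
    lim_base a s `<=` lim_base a q `&` lim_base a r.
Proof.
have le_dir b c m l : lt b c -> lt c a -> exists2 s, below lt s.1 a &
    lim_base a s `<=` lim_base a (Some b, m) `&` lim_base a (Some c, l).
  move=> bc ca; have [k kP] := @lim_base_mono a b c (maxn m l) bc.
  exists (Some c, maxn (maxn m l) k) => // p sp; split.
    by have [] := lim_base_maxn (kP p sp).
  by have [/lim_base_maxn[]] := lim_base_maxn sp.
have None_le b m : lim_base a (b, m) `<=` lim_base a (None, m).
  by move=> p [ha nh]; split=> // -[//|hm]; apply: nh; right.
case: q r => [[b|] m] [[c|] l] /= ba ca.
- have [bc|<-|cb] := lt_total b c; first exact: le_dir.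
    by exists (Some b, maxn m l) => //; exact: lim_base_maxn.
  by rewrite setIC; exact: le_dir.
- exists (Some b, maxn m l) => // p /lim_base_maxn[h1 h2]; split=> //.
  exact: None_le h2.
- exists (Some c, maxn m l) => // p /lim_base_maxn[h1 h2]; split=> //.
  exact: None_le h1.
- by exists (None, maxn m l) => //; exact: lim_base_maxn.
Qed.

Let topT : tower_open setT.
Proof.
by move=> [n z|a] _; [exists 0|exists (None, 0)].
Qed.

Let topI : setI_closed tower_open.
Proof.
move=> U V Uo Vo [n z|a] [/Uo + /Vo].
  move=> [k kU] [l lV]; exists (maxn k l) => -[n' z'|//] [-> zz].
  split; [apply: kU|apply: lV]; split=> // i ik;
    by apply: zz; rewrite leq_max ik ?orbT.
move=> [q qa qU] [r ra rV]; have [s sa sqr] := lim_base_dir qa ra.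
by exists s => // p /sqr[/qU ? /rV].
Qed.

Let top_bigU (I : Type) (f : I -> set X) :
  (forall i, tower_open (f i)) -> tower_open (\bigcup_i f i).
Proof.
move=> fo [n z|a] [i _ /fo].
  by move=> [k kf]; exists k => p /kf fp; exists i.
by move=> [q qa qf]; exists q => // p /qf fp; exists i.
Qed.

HB.instance Definition _ := isOpenTopological.Build X topT topI top_bigU.

Lemma tower_openE (U : set X) : open U = tower_open U.
Proof. by []. Qed.

Lemma hull_open a : open (hull a).
Proof.
rewrite tower_openE => -[n z|c] /=.
  have [k kP] := tower_clopen (ot_tower OT) a n.
  move=> nOz; exists k => -[n' z'|//] [-> zz] /= Oz'; apply: nOz.
  by apply: kP Oz' => i /zz.
case=> [ca|->]; last by exists (None, 0) => // p [].
have [m mP] := tower_decreasing (ot_tower OT) ca.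
exists (None, m) => // -[n z|d] [hc nm] /=.
  move=> Oa; apply: hc; apply: mP Oa; rewrite leqNgt; apply/negP => nm'.
  by apply: nm; right.
by left; case: hc => [dc|->//]; exact: lt_trans dc ca.
Qed.

Lemma hull_closed a : closed (hull a).
Proof.
rewrite -openC tower_openE => -[n z|c] /= nh.
  have [k kP] := tower_clopen (ot_tower OT) a n.
  exists k => -[n' z'|//] [-> zz] /= nO; apply: nO.
  by apply: kP zz _; exact: contrapT.
have ac : lt a c.
  have [ca|ca|//] := lt_total c a; exfalso; apply: nh; [by left|by right].
by exists (Some a, 0) => // p [_ nap] ap; apply: nap; left.
Qed.

Lemma initial_slices_open m : open (initial_slices m).
Proof.
by rewrite tower_openE => -[n z /= nm|//]; exists 0 => -[n' z'|//] [->].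
Qed.

Lemma initial_slices_closed m : closed (initial_slices m).
Proof.
rewrite -openC tower_openE => -[n z|a] nm.
  by exists 0 => -[n' z'|//] [->].
by exists (None, m) => // p [_ np] mp; apply: np; right.
Qed.

Lemma ohull_closed b : closed (ohull b).
Proof. by case: b => [b|]; [exact: hull_closed|exact: closed0]. Qed.

Lemma lim_base_open a q : open (lim_base a q).
Proof.
apply: openI; first exact: hull_open.
apply: closed_openC; apply: closedU; first exact: ohull_closed.
exact: initial_slices_closed.
Qed.

Lemma lim_base_mem a q : below lt q.1 a -> lim_base a q (Lim a).
Proof.
case: q => b m /= ba; split; first by right.
by case=> //; case: b ba => //= b ba [ab|ab]; apply: (@lt_irr a);
  [exact: lt_trans ab ba|rewrite {1}ab].
Qed.

Lemma cpt_base_open n z k : open (cpt_base n z k).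
Proof.
rewrite tower_openE => -[n' z'|//] [-> zz]; exists k => -[n'' z''|//] [-> zz'].
by split=> // i ik; rewrite zz' // zz.
Qed.

Lemma cpt_base_mem n z k : cpt_base n z k (Cpt n z).
Proof. by split. Qed.

Definition point_base (p : X) : set (set X) :=
  match p with
  | Cpt n z => range (cpt_base n z)
  | Lim a => lim_base a @` [set q | below lt q.1 a]
  end.

Lemma point_base_local p : local_base p (point_base p).
Proof.
case: p => [n z|a]; split.
- by move=> _ [k _ <-]; split; [exact: cpt_base_open|exact: cpt_base_mem].
- move=> U [Uo Up]; have [k kU] := Uo _ Up.
  by exists (cpt_base n z k) => //; exists k.
- by move=> _ [q qa <-]; split; [exact: lim_base_open|exact: lim_base_mem].
- move=> U [Uo Up]; have [q qa qU] := Uo _ Up.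
  by exists (lim_base a q) => //; exists q.
Qed.

Lemma few_point_base p : pseudointersection_number !=set0 ->
  (forall a, ~ (pseudointersection_number #<= [set b | lt b a])) ->
  ~ (pseudointersection_number #<= point_base p).
Proof.
move=> p0 afew; case: p => [n z|a].
  by apply: few_countable => //; exact: card_image_le.
move=> h; apply: (few_below p0 (afew a)); apply: card_le_trans h _.
exact: card_image_le.
Qed.

Lemma hausdorff_tower_space : hausdorff_space X.
Proof.
rewrite open_hausdorff.
suff sep : forall x y : X, x <> y ->
    exists U V : set X, [/\ open U, open V, U x, V y & U `&` V `<=` set0].
  move=> x y /eqP/sep[U [V [Uo Vo Ux Vy UV]]]; exists (U, V).
    by split; exact: mem_set.
  by split=> //; apply/eqP; rewrite -subset0.
have sepJ a b : lt a b ->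
    exists U V : set X, [/\ open U, open V, U (Lim a), V (Lim b) &
      U `&` V `<=` set0].
  move=> ab; exists (hull a), (lim_base b (Some a, 0)); split.
  - exact: hull_open.
  - exact: lim_base_open.
  - by right.
  - exact: lim_base_mem.
  - by move=> p [ap [_ nap]]; apply: nap; left.
have sepL n z a :
    exists U V : set X, [/\ open U, open V, U (Cpt n z), V (Lim a) &
      U `&` V `<=` set0].
  exists (initial_slices n.+1), (lim_base a (None, n.+1)); split.
  - exact: initial_slices_open.
  - exact: lim_base_open.
  - exact: ltnSn.
  - exact: lim_base_mem.
  - by move=> p [ap [_ nap]]; apply: nap; right.
have symm (x y : X) : (exists U V : set X, [/\ open U, open V, U x, V y &
    U `&` V `<=` set0]) -> exists U V : set X, [/\ open U, open V, U y, V x &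
    U `&` V `<=` set0].
  by move=> [U [V [Uo Vo Ux Vy UV]]]; exists V, U; split=> //; rewrite setIC.
move=> [n z|a] [n' z'|a'] xy.
- have [nn|nn] := eqVneq n' n; last first.
    exists (cpt_base n z 0), (cpt_base n' z' 0); split=> //;
      try exact: cpt_base_open; try exact: cpt_base_mem.
    by move=> [m w|? []//] [[mn _] [mn' _]]; rewrite -mn -mn' eqxx in nn.
  have [i zi] : exists i, z i <> z' i.
    apply: contrapT => zz; apply: xy; rewrite nn; congr Cpt.
    by apply: funext => i; apply: contrapT => zi; apply: zz; exists i.
  exists (cpt_base n z i.+1), (cpt_base n' z' i.+1); split=> //;
    try exact: cpt_base_open; try exact: cpt_base_mem.
  move=> [m w|? []//] [[_ wz] [_ wz']]; apply: zi.
  by rewrite -wz // wz'.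
- exact: sepL.
- exact/symm/sepL.
- have [ab|ab|ba] := lt_total a a'; first exact: sepJ.
    by exfalso; apply: xy; rewrite ab.
  exact/symm/sepJ.
Qed.

(** * Convergence of ultrafilters and compactness *)

Lemma ultra_initial_slices (F : set_system X) m : UltraFilter F ->
  F (initial_slices m) -> exists p : X, F --> p.
Proof.
move=> FU; elim: m => [|m IH] Fm.
  by have [[n z|a]] := filter_ex Fm.
have [/IH//|Fm'] := in_ultra_setVsetC (initial_slices m) FU.
(* The ultrafilter now lives on slice [m]; it decides every coordinate, and the decided bits form
   its limit. *)
pose z i := `[< F [set p : X | if p is Cpt _ w then w i else false] >].
exists (Cpt m z : X) => U; rewrite nbhsE => -[V [Vo Vp] VU].
have [k kV] := Vo _ Vp; suff Fk : F (cpt_base m z k).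
  by apply: filterS Fk => p /kV/VU.
elim: k {kV} => [|k IHk].
  apply: filterS (filterI Fm Fm') => -[n w|? []//] [/= nm nm']; split=> //.
  by apply/eqP; rewrite eqn_leq -ltnS nm leqNgt; apply/negP.
have Fz : F [set p : X | if p is Cpt _ w then w k = z k else False].
  rewrite /z; case: asboolP => [|nF]; first by apply: filterS => -[].
  have [//|] := in_ultra_setVsetC
    [set p : X | if p is Cpt _ w then w k else false] FU.
  move=> Fk; apply: filterS (filterI Fk IHk) => -[n w|? []//] [/= wk _].
  exact/negP.
apply: filterS (filterI IHk Fz) => -[n w|? []//] [[-> wz] /= wk]; split=> // i.
by rewrite ltnS leq_eqVlt => /orP[/eqP ->|/wz].
Qed.

(* The limit of an ultrafilter that contains hull a is Lim c for the least c
   such that hull c belongs to it, unless the ultrafilter lives on finitely many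
   slices. *)
Lemma ultra_hull (F : set_system X) a : UltraFilter F -> F (hull a) ->
  exists p : X, F --> p.
Proof.
move=> FU; elim: (ot_wf OT a) => {}a _ IH Fa.
have [[b ba Fb]|nb] := pselect (exists2 b, lt b a & F (hull b)).
  exact: IH Fb.
have [[m Fm]|nm] := pselect (exists m, F (initial_slices m)).
  exact: ultra_initial_slices Fm.
exists (Lim a) => U; rewrite nbhsE => -[V [Vo Vp] VU].
have [[b m] /= ba bV] := Vo _ Vp.
apply: filterS (subset_trans bV VU) _; apply: filterI => //.
have [|//] := in_ultra_setVsetC (ohull b `|` initial_slices m) FU.
move=> Fbm; have [Fm|Fm] := in_ultra_setVsetC (initial_slices m) FU.
  by exfalso; apply: nm; exists m.
have : F (ohull b) by apply: filterS (filterI Fbm Fm) => p [[]].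
case: b ba {bV Fbm} => [b ba Fb|_ F0]; first by exfalso; apply: nb; exists b.
by have [p []] := filter_ex F0.
Qed.

Lemma compact_hullU a m : compact (hull a `|` initial_slices m).
Proof.
rewrite compact_ultra => F FU Fam.
have [p Fp] : exists p : X, F --> p.
  have [|/(filterI Fam) Fm] := in_ultra_setVsetC (hull a) FU.
    exact: ultra_hull.
  apply: (@ultra_initial_slices F m) => //.
  by apply: filterS Fm => p [[]].
exists p; split=> //; apply: contrapT => np.
have /Fp Fn : nbhs p (~` (hull a `|` initial_slices m)).
  apply: open_nbhs_nbhs; split=> //; apply: closed_openC; apply: closedU.
    exact: hull_closed.
  exact: initial_slices_closed.
by have [q []] := filter_ex (filterI Fam Fn).
Qed.

Lemma hullU_open a m : open (hull a `|` initial_slices m).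
Proof. by apply: openU; [exact: hull_open|exact: initial_slices_open]. Qed.

Lemma hullU_closed a m : closed (hull a `|` initial_slices m).
Proof. by apply: closedU; [exact: hull_closed|exact: initial_slices_closed]. Qed.

Lemma tower_cover (a : J) (p : X) :
  exists q, (hull q.1 `|` initial_slices q.2) p.
Proof.
case: p => [n z|b]; first by exists (a, n.+1); right; exact: ltnSn.
by exists (b, 0); left; right.
Qed.

Lemma locally_compact_tower_space (a : J) : locally_compact [set: X].
Proof.
move=> p _; have [[b m] bp] := tower_cover a p.
exists (hull b `|` initial_slices m).
  apply: filterS (_ : nbhs p _); last first.
    by apply: open_nbhs_nbhs; split; [exact: hullU_open|exact: bp].
  by move=> q.
by split; [exact: compact_hullU|exact: hullU_closed].
Qed.

Lemma hullU_dir (q r : J * nat) : exists s : J * nat,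
  (hull q.1 `|` initial_slices q.2) `|` (hull r.1 `|` initial_slices r.2) `<=`
  hull s.1 `|` initial_slices s.2.
Proof.
have le_dir a b m n : lt a b \/ a = b -> exists l,
    (hull a `|` initial_slices m) `|` (hull b `|` initial_slices n) `<=`
    hull b `|` initial_slices (maxn l (maxn m n)).
  move=> ab; have [l lP] : exists l, forall n, l <= n -> O b n `<=` O a n.
    case: ab => [ab|->]; last by exists 0 => ? _ ?.
    exact: (tower_decreasing (ot_tower OT) ab).
  exists l => -[k z|c] /=.
    have [kl|lk] := ltnP k (maxn l (maxn m n)); first by move=> _; right.
    move: lk; rewrite !geq_max => /and3P[lk mk nk].
    case=> -[hk|]; rewrite /= ?ltnNge ?mk ?nk //; left => //= Ob.
    by apply: hk; exact: lP Ob.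
  case=> -[hk|[]]; left => //=; case: ab => [ab|<-//].
  by left; case: hk => [ca|->//]; exact: lt_trans ca ab.
case: q r => [a m] [b n] /=; have [ab|ab|ba] := lt_total a b.
- have [l lP] := le_dir a b m n (or_introl ab).
  by exists (b, maxn l (maxn m n)).
- have [l lP] := le_dir a b m n (or_intror ab).
  by exists (b, maxn l (maxn m n)).
- have [l lP] := le_dir b a n m (or_introl ba); exists (a, maxn l (maxn n m)).
  by rewrite setUC.
Qed.

Definition cantor_part : set X := fun p => if p is Cpt _ _ then True else False.

(** By directedness [C] lies in a single [hull b] together with [m] slices, while [O b] is nonempty
    on some slice from [m] on. *)
Lemma cantor_part_not_covered (a : J) (C : set X) : compact C ->
  cantor_part `\` C !=set0.
Proof.
move=> /(@compact_directed_cover X (J * nat)%type (a, 0)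
  (fun q => hull q.1 `|` initial_slices q.2)).
move=> [q|q r|p|[b m] Cb]; first exact: hullU_open.
- exact: hullU_dir.
- exact: tower_cover.
have [n mn [z Oz]] := tower_infinite (ot_tower OT) b m.
by exists (Cpt n z); split=> // /Cb[/(_ Oz)//|]; rewrite /= ltnNge mn.
Qed.

(** * Discrete generation of the space *)

Lemma countable_dense_part (A : set X) : A `<=` cantor_part -> A !=set0 ->
  exists e : nat -> X, range e `<=` A /\ A `<=` closure (range e).
Proof.
move=> AY [a0 Aa0].
pose W (nt : nat * seq bool) : set X := fun p =>
  if p is Cpt n z then n = nt.1 /\ cylinder nt.2 z else False.
(* The index [i] codes a slice and a word; the chosen point of [A] lies in that basic set whenever
   [A] meets it. *)
have ex i : exists x, A x /\ forall nt, unpickle i = Some nt ->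
    (A `&` W nt) !=set0 -> W nt x.
  case: (unpickle i) => [nt|]; last by exists a0.
  have [[x [Ax Wx]]|nW] := pselect ((A `&` W nt) !=set0); last first.
    by exists a0; split=> // _ [<-] /nW.
  by exists x; split=> // _ [<-].
have [e eP] := choice ex; exists e; split=> [_ [i _ <-]|x Ax U].
  by have [] := eP i.
rewrite nbhsE => -[V [Vo Vx] VU]; have := AY _ Ax.
case: x Ax Vx => [n z Ax Vx _|//]; have [k kV] := Vo _ Vx.
pose nt := (n, mkseq z k); have [_ /(_ nt (pickleK nt)) eW] := eP (pickle nt).
have : W nt (e (pickle nt)).
  by apply: eW; exists (Cpt n z); split=> //; split=> //; exact/cylinder_mkseq.
move=> Wx; exists (e (pickle nt)); split; first by exists (pickle nt).
apply/VU/kV; move: Wx; rewrite /W; case: (e _) => // n' z' [-> zz]; split=> //.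
exact/cylinder_mkseq.
Qed.

(* The complement of the Cantor part is scattered, hence the isolated points of
   any of its subsets form a dense discrete subset. *)
Lemma discretely_generated_tower_space : pseudointersection_number !=set0 ->
  (forall a, ~ (pseudointersection_number #<= [set b | lt b a])) ->
  discretely_generated X.
Proof.
move=> p0 afew p A Ap.
have [Ap'|nAp] := pselect (A p).
  exists [set p]; split; first by move=> x ->.
    apply/discrete_subsetP => _ ->; exists setT; rewrite setTI.
    by split => //; split=> //; exact: openT.
  exact: subset_closure.
have : closure ((A `&` cantor_part) `|` (A `&` ~` cantor_part)) p.
  by rewrite -setIUr setUCr setIT.
rewrite closureU => -[Ac|Al].
  have [x [xAc _]] := Ac _ filterT.
  have [||e [eA Ae]] := @countable_dense_part (A `&` cantor_part).
  - by move=> y [].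
  - by exists x.
  have [|||||D [De Dd Dp]] := @discrete_of_countable X e p (point_base p).
  - exact: hausdorff_tower_space.
  - exact: point_base_local.
  - exact: few_point_base.
  - have /closure_id -> := @closed_closure _ (range e); exact: (closureS Ae Ac).
  - by move=> /eA[].
  by exists D; split=> // x' /De/eA[].
pose D := [set x | (A `&` ~` cantor_part) x /\ exists V, open_nbhs x V /\
  V `&` (A `&` ~` cantor_part) `<=` [set x]].
exists D; split.
- by move=> x [[]].
- apply/discrete_subsetP => x [_ [V [Vx VA]]]; exists V; split=> //.
  by move=> y [Vy [Ay _]]; exact: VA.
move=> U; rewrite nbhsE => -[V [Vo Vp] VU].
have [x [Ax Vx]] := Al _ (open_nbhs_nbhs (conj Vo Vp)).
case: x Ax Vx => [n z [_ /(_ I)//]|a].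
(* Descend to an index [a] with no smaller one in [A] and [V]; intersecting [V] with [hull a] then
   isolates [Lim a] in the part of [A] off the Cantor part. *)
elim: (ot_wf OT a) => {}a _ IH Aa Va.
have [[b ba [Ab Vb]]|nb] := pselect (exists2 b, lt b a &
    (A `&` ~` cantor_part) (Lim b) /\ V (Lim b)).
  exact: IH Ab Vb.
exists (Lim a); split; last exact: VU.
split=> //; exists (V `&` hull a); split.
  by split; [apply: openI => //; exact: hull_open|split=> //; right].
move=> [n z|b] [[Vb hb] Ab]; first by have [_ /(_ I)] := Ab.
case: hb => [ba|->//]; exfalso; apply: nb; exists b => //.
Qed.

End tower_space.

Arguments hull {J lt O} OT.
Arguments initial_slices {J lt O} OT.
Arguments cantor_part {J lt O} OT.

(** * The one-point compactification *)

Lemma cofinal_cof_meager : cofinal_meager cof_meager.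
Proof.
have [|//] := @least_cardP _ cofinal_meager.
by exists meager; split=> // A Am; exists A.
Qed.

Lemma cof_meager_neq0 : cof_meager !=set0.
Proof.
have [_ /(_ set0)[|B CB _]] := cofinal_cof_meager; last by exists B.
exists (fun=> set0) => [n|]; first by apply/nowhere_denseP; exact: rare0.
by rewrite bigcup0.
Qed.

Lemma character_le {X : topologicalType} (x : X) B : local_base x B ->
  character x #<= B.
Proof.
by move=> xB; have [|_] := @least_cardP _ (local_base x); [exists B|apply].
Qed.

Lemma one_point_nbhs_None {X : topologicalType} (C : set X) :
  compact C -> closed C ->
  nbhs (None : one_point_compactification X) (Some @` (~` C) `|` [set None]).
Proof. by move=> Cc Ccl; exists C. Qed.

Section main_space.
Context {J : choiceType} {lt : J -> J -> Prop}.
Context {O : J -> nat -> set (nat -> bool)} (OT : ordinal_tower lt O).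
Local Notation X := (tower_space OT).
Local Notation opc := (one_point_compactification X).
Context (p_neq0 : pseudointersection_number !=set0).
Context (J_p : [set: J] #= pseudointersection_number).
Context (lt_few :
  forall a, ~ (pseudointersection_number #<= [set b | lt b a])).

(** Strictness comes from [few_point_base], the weak inequality from absorbing two factors [nat]
    into the infinite set [J]. *)
Lemma character_lt (x : X) : card_lt (character x) pseudointersection_number.
Proof.
have cx := character_le (point_base_local x).
split; last by move=> /card_le_trans/(_ cx); exact: few_point_base.
apply: card_le_trans cx _.
have pinf : infinite_set pseudointersection_number.
  by move=> /finite_set_countable; exact: pseudointersection_number_uncountable.
have [Jp pJ] := andP (etrans (esym (card_eq_le _ _)) J_p).
have Jinf : infinite_set [set: J].
  by move=> Jfin; apply: pinf; exact: card_le_finite pJ Jfin.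
case: x => [n z|a].
  apply: card_le_trans (card_image_le _ _) _; exact/infiniteP.
apply: card_le_trans (card_image_le _ _) _.
apply: card_le_trans (card_below_le lt a a) _; apply: card_le_trans _ Jp.
have JN := card_leX_nat Jinf; apply: card_le_trans JN.
apply: card_leX_nat => JNfin; apply: Jinf; apply: card_le_finite JNfin.
by apply: (@card_le_surj _ _ _ _ fst) => a' _; exists (a', 0).
Qed.

(** A cylinder isolates a point [w] of [D] on its slice. Flipping a coordinate of [w] beyond that
    cylinder and the given prefix yields a smaller cylinder missing [D]. *)
Lemma discrete_slice_rare (D : set opc) n : discrete_subset D ->
  rare [set z | D (Some (Cpt n z : X))].
Proof.
move=> /discrete_subsetP Dd; apply: (rareI false) => z m.
have [[w wz Dw]|nw] := pselect (exists2 w : nat -> bool,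
    (forall i, i < m -> w i = z i) & D (Some (Cpt n w : X))); last first.
  by exists z, m; split=> // x xz Dx; apply: nw; exists x.
have [V [/open_nbhs_nbhs Vw VD]] := Dd _ Dw.
have : nbhs (Cpt n w : X) (Some @^-1` V) by exact: Vw.
rewrite nbhsE => -[U [Uo Uw] UV]; have [k kU] := Uo _ Uw.
pose l := maxn k m.
exists (fun i => if i == l then ~~ w i else w i), l.+1; split=> [i im|x xw Dx].
  by rewrite ltn_eqF ?wz // (leq_trans im) // leq_maxr.
have [xw'] : (Some (Cpt n x : X) : opc) = Some (Cpt n w : X).
  apply: VD; split=> //; apply/UV/kU; split=> // i ik.
  have il : i < l by rewrite (leq_trans ik) // leq_maxl.
  by rewrite (xw i (leqW il)) ltn_eqF.
by have := xw l (ltnSn l); rewrite eqxx xw'; case: (w l).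
Qed.

(** Infinity is in the closure of the Cantor part, but [cover] encloses each of its discrete subsets
    in a compact set [hull a] plus finitely many slices, whose complement is a neighbourhood of
    infinity. *)
Lemma one_point_not_discretely_generated (a0 : J)
    (cover : forall D : nat -> set (nat -> bool), (forall n, rare (D n)) ->
      exists a m, forall n z, m <= n -> D n z -> ~ O a n z) :
  ~ discretely_generated opc.
Proof.
move=> /(_ None (Some @` cantor_part OT))[|D [DA Dd DNone]].
  move=> U [C [Cc _] CU]; have [x [Yx Cx]] := cantor_part_not_covered a0 Cc.
  by exists (Some x); split; [exists x|apply: CU; left; exists x].
have [a [m amD]] := cover _ (fun n => discrete_slice_rare n Dd).
pose C : set X := hull OT a `|` initial_slices OT m.
have [|y [Dy]] := DNone (Some @` (~` C) `|` [set None]).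
  by apply: one_point_nbhs_None; [exact: compact_hullU|exact: hullU_closed].
have [x Yx xy] := DA _ Dy; rewrite -xy in Dy *.
case=> // -[x' nx' [x'x]]; rewrite x'x in nx'; apply: nx'.
case: x Yx Dy {xy x'x} => // n z _ Dz.
by have [nm|mn] := ltnP n m; [right|left; exact: amD Dz].
Qed.

End main_space.

Theorem theorem1p3 :
  pseudointersection_number #= cof_meager ->
  exists X : topologicalType,
    [/\ locally_compact [set: X],
        hausdorff_space X,
        discretely_generated X,
        ~ discretely_generated (one_point_compactification X) &
        forall x : X, card_lt (character x) pseudointersection_number].
Proof.
move=> pC; have [_ pC2] := andP (etrans (esym (card_eq_le _ _)) pC).
(* A cofinal family has a member, so neither cardinal is zero; in particular p is not the default
   value of [least_card]. *)
have p0 : pseudointersection_number !=set0.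
  apply/set0P/eqP => p0; move: pC2; rewrite p0 card_le0 => /eqP C0.
  by have [B] := cof_meager_neq0; rewrite C0.
have [J [lt [lt_wf lt_tr lt_tot Jp lt_few]]] :=
  ordinal_index pseudointersection_number.
have [N [rN Ncof]] := cofinal_rare_sequences cofinal_cof_meager.
have [_ pJ] := andP (etrans (esym (card_eq_le _ _)) Jp).
(* As cof(M) is at most p, [g] enumerates a cofinal family along [J], and each of its members is
   treated at some stage of the tower. *)
have [g gP] := card_le_exsurj cof_meager_neq0 (card_le_trans pC2 pJ).
have [O towO ON] := tower_exists lt_wf lt_tr lt_tot p0 lt_few (fun a => rN (g a)).
pose OT := OrdinalTower lt_wf lt_tr lt_tot towO.
have [a0 _] : [set: J] !=set0.
  by apply/set0P/eqP => J0; move: pJ; rewrite J0 card_le0; exact/negP/set0P.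
exists (tower_space OT); split.
- exact: locally_compact_tower_space.
- exact: hausdorff_tower_space.
- exact: discretely_generated_tower_space.
- apply: one_point_not_discretely_generated => // D /Ncof[M CM [m DN]].
  have [a _ ga] := gP _ CM; exists a, m => n z mn Dz Oz.
  by apply: ON Oz _; rewrite ga; exact: DN Dz.
- exact: character_lt.
Qed.
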